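(* Let $G$ and $H$ be vertex-disjoint graphs, and let $G\cup H$ be their disjoint union. Then $$\sigma_1(G\cup H)=\sigma_1(G)\,\sigma_0(H)+\sigma_0(G)\,\sigma_1(H).$$
   Context: Graphs are finite, simple and undirected. For a graph $G$ and $k\in\{0,1\}$, $\sigma_k(G)$ denotes the number of subsets $I$ of the vertex set $V(G)$ such that the subgraph of $G$ induced by $I$ has exactly $k$ edges. Thus $\sigma_0(G)$ is the number of independent vertex subsets (including the empty set) and $\sigma_1(G)$ is the number of $1$-nearly independent vertex subsets. *)

(* Defs.v *)
From mathcomp Require Import all_boot finmap.

Set Implicit Arguments.
Unset Strict Implicit.
Unset Printing Implicit Defensive.

Local Open Scope fset_scope.

(* Finite simple undirected graphs whose vertices are drawn from T; an edge is
   the two-element set of its endpoints.  Keeping the vertex set explicit lets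
   two graphs over the same T be vertex-disjoint. *)
Record graph (T : choiceType) := Graph {
  vertices : {fset T};
  edges : {fset {fset T}};
  edgesP : forall e, e \in edges -> e `<=` vertices /\ #|` e| = 2 }.

Section GraphOperations.
Variable T : choiceType.
Implicit Types (G H : graph T) (I : {fset T}).

Lemma inducedP G I e :
  e \in [fset e in edges G | e `<=` I] ->
  e `<=` vertices G `&` I /\ #|` e| = 2.
Proof.
rewrite !inE /= => /andP[/edgesP[eV e2] eI].
by rewrite fsubsetI eV eI.
Qed.

Definition induced G I : graph T := Graph (@inducedP G I).

Lemma graph_unionP G H e :
  e \in edges G `|` edges H ->
  e `<=` vertices G `|` vertices H /\ #|` e| = 2.
Proof.
rewrite inE => /orP[] /edgesP[eV e2]; split=> //; apply: fsubset_trans eV _.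
  exact: fsubsetUl.
exact: fsubsetUr.
Qed.

(* This is the disjoint union when the vertex sets are disjoint. *)
Definition graph_union G H : graph T := Graph (@graph_unionP G H).

Definition sigma (k : nat) G : nat :=
  #|` [fset I in fpowerset (vertices G) | #|` edges (induced G I)| == k]|.

End GraphOperations.

(* Main.v *)
Require Import Defs.
From mathcomp Require Import all_boot finmap.

Set Implicit Arguments.
Unset Strict Implicit.
Unset Printing Implicit Defensive.

Local Open Scope fset_scope.
Local Open Scope nat_scope.

(** The subsets of [V(G) ∪ V(H)] are the unions of a subset [A] of [V(G)] and a
    subset [B] of [V(H)], uniquely so, and the edges induced by [A ∪ B] are
    those induced by [A] in [G] and by [B] in [H].  Hence [sigma k] of the union
    is the convolution of the sequences [sigma _ G] and [sigma _ H]. *)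

(** This gives the uniqueness of the decomposition: each part is recovered from the union as its
    trace on [V] or, by symmetry, on [W]. *)
Lemma fsetIU_disjoint (T : choiceType) (V W A B : {fset T}) :
  [disjoint V & W] -> A `<=` V -> B `<=` W -> (A `|` B) `&` V = A.
Proof.
move=> /fdisjointP VW /fsubsetP AV /fsubsetP BW; apply/fsetP => x.
rewrite !inE; have [/AV -> //|xA /=] := boolP (x \in A).
by apply/andP => -[/BW xW /VW]; rewrite xW.
Qed.

(** Stated as a permutation of lists so that a sum over the subsets of [V ∪ W] can be reindexed as a
    double sum. *)
Lemma perm_fpowersetU (T : choiceType) (V W : {fset T}) :
  [disjoint V & W] ->
  perm_eq (fpowerset (V `|` W))
          [seq A `|` B | A <- fpowerset V, B <- fpowerset W].
Proof.
move=> VW; have WV : [disjoint W & V] by rewrite fdisjoint_sym.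
apply: uniq_perm; first exact: fset_uniq.
  apply: allpairs_uniq; rewrite ?fset_uniq // => -[A B] [A' B'].
  move=> /allpairsP[[? ?] /= [+ + [-> ->]]] /allpairsP[[? ?] /= [+ + [-> ->]]].
  rewrite !fpowersetE => AV BW AV' BW' /= eqU; congr pair.
    by rewrite -(fsetIU_disjoint VW AV BW) eqU (fsetIU_disjoint VW).
  by rewrite -(fsetIU_disjoint WV BW AV) fsetUC eqU fsetUC (fsetIU_disjoint WV).
move=> I; rewrite fpowersetE; apply/idP/allpairsP => [IVW|[[A B] /=]].
  exists (I `&` V, I `&` W); rewrite !fpowersetE !fsubsetIr.
  by rewrite -fsetIUr; split=> //; apply/esym/fsetIidPl.
by rewrite !fpowersetE => -[AV BW ->]; apply: fsetUSS.
Qed.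

Section GraphUnion.
Variable T : choiceType.
Implicit Types (G H : graph T) (A B : {fset T}).

Lemma sigmaE k G :
  sigma k G =
  \sum_(A <- fpowerset (vertices G)) (#|` edges (induced G A)| == k).
Proof. by rewrite /sigma card_fset_sum1 big_fset big_mkcond. Qed.

(** No endpoint of an edge of [G] lies in [B], which sits inside [W] and so away from the vertices
    of [G]. *)
Lemma edge_fsubsetU G A B W e :
    [disjoint vertices G & W] -> B `<=` W -> e \in edges G ->
  (e `<=` A `|` B) = (e `<=` A).
Proof.
move=> /fdisjointP GW /fsubsetP BW /edgesP[/fsubsetP eG _].
apply/idP/idP => [/fsubsetP eAB|]; last first.
  by move=> /fsubset_trans; apply; apply: fsubsetUl.
apply/fsubsetP => x xe; have := eAB x xe.
by rewrite inE => /orP[//|/BW xW]; rewrite (negPf (GW x (eG x xe))) in xW.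
Qed.

(** A common edge would lie in the empty intersection of the vertex sets, yet it has two
    endpoints. *)
Lemma edges_disjoint G H :
  [disjoint vertices G & vertices H] -> [disjoint edges G & edges H].
Proof.
move=> GH; apply/fdisjointP => e /edgesP[eG e2]; apply/negP => /edgesP[eH _].
have : e `<=` vertices G `&` vertices H by rewrite fsubsetI eG eH.
by rewrite (eqP GH) fsubset0 => /eqP e0; rewrite e0 cardfs0 in e2.
Qed.

Lemma card_edges_induced_union G H A B :
    [disjoint vertices G & vertices H] ->
    A `<=` vertices G -> B `<=` vertices H ->
  #|` edges (induced (graph_union G H) (A `|` B))| =
  #|` edges (induced G A)| + #|` edges (induced H B)|.
Proof.
move=> GH AG BH; have HG : [disjoint vertices H & vertices G].
  by rewrite fdisjoint_sym.
have -> : edges (induced (graph_union G H) (A `|` B)) =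
          edges (induced G A) `|` edges (induced H B).
  apply/fsetP => e; rewrite !inE /= andb_orl; congr orb.
    by apply: andb_id2l => eG; apply: edge_fsubsetU eG; first exact: GH.
  by apply: andb_id2l => eH; rewrite fsetUC; apply: edge_fsubsetU eH; first exact: HG.
(* The two induced edge sets are disjoint, so the cardinality of their union has no correction
   term. *)
rewrite cardfsU (_ : _ `&` _ = fset0) ?cardfs0 ?subn0 //.
apply/eqP; apply: fdisjointWl (fdisjointWr _ (edges_disjoint GH));
  by apply/fsubsetP => e; rewrite !inE => /andP[].
Qed.

Lemma sigma_graph_union k G H :
    [disjoint vertices G & vertices H] ->
  sigma k (graph_union G H) = \sum_(i < k.+1) sigma i G * sigma (k - i) H.
Proof.
move=> GH; rewrite sigmaE (perm_big _ (perm_fpowersetU GH)) big_allpairs_dep /=.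
under [RHS]eq_bigr do rewrite !sigmaE big_distrlr.
(* Moving the sum over [i] innermost leaves, for fixed [A] and [B], an identity between 0/1
   indicators. *)
rewrite [RHS]exchange_big; apply: eq_big_seq => A; rewrite fpowersetE => AG.
rewrite [RHS]exchange_big; apply: eq_big_seq => B; rewrite fpowersetE => BH.
rewrite card_edges_induced_union //=.
set a := #|` _|; set b := #|` _|.
(* If [a > k], both sides vanish; otherwise only [i = a] can contribute. *)
have [ltka|leak] := ltnP k a.
  rewrite big1 => [|i _]; first by rewrite gtn_eqF // ltn_addr.
  by rewrite gtn_eqF // (leq_trans (ltn_ord i)).
rewrite (bigD1 (Ordinal (leak : a < k.+1))) //= eqxx mul1n big1 ?addn0.
  (* As [a <= k], the subtraction [k - a] is not truncated, so [b == k - a] amounts to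
     [a + b == k]. *)
  by rewrite -(eqn_add2l a b) subnKC.
by move=> i; rewrite -val_eqE /= eq_sym => /negPf ->.
Qed.

End GraphUnion.

Theorem mainTheorem6 (T : choiceType) (G H : graph T)
    (disjGH : [disjoint vertices G & vertices H]%fset) :
  sigma 1 (graph_union G H) = sigma 1 G * sigma 0 H + sigma 0 G * sigma 1 H.
Proof. by rewrite sigma_graph_union // !big_ord_recl big_ord0 addn0 addnC. Qed.
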